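(* Let $k<n$ be positive integers, $J=\{1,\dots,n\}$, and let integers $b^i_j$ ($j\in J$, $1\le i\le k$), nonzero integers $a_1,\dots,a_n$, an integer $\kappa$ and a prime $p$ be given as in the context, with $p$ good and $p\nmid\kappa$. Let $A=(A_1,\dots,A_n)$ be positive integers with $[A_j]=[a_j]/[\kappa]$ in $\mathbb F_p$ for all $j\in J$. Let $q=(q_1,\dots,q_k)\in\mathbb Z^k$ and let $l_1,\dots,l_k$ be positive integers. For each independent $\{j_1<\dots<j_k\}\subset J$ consider the polynomial $$X_{j_1,\dots,j_k}(z,t,A)=\Big(\prod_{j\in J}f_j(z,t)^{A_j}\Big)\frac{d_{j_1,\dots,j_k}}{\prod_{l=1}^k f_{j_l}(z,t)}\in\mathbb Z[z_1,\dots,z_n,t_1,\dots,t_k]$$ and its Taylor expansion $X_{j_1,\dots,j_k}(z,t,A)=\sum_{i_1,\dots,i_k\ge0}I^{i_1,\dots,i_k}_{j_1,\dots,j_k}(z,q,A)(t_1-q_1)^{i_1}\cdots(t_k-q_k)^{i_k}$ with $I^{i_1,\dots,i_k}_{j_1,\dots,j_k}(z,q,A)\in\mathbb Z[z_1,\dots,z_n]$. Let $[I]^{i_1,\dots,i_k}_{j_1,\dots,j_k}(z,q,A)\in\mathbb F_p[z_1,\dots,z_n]$ denote the coefficientwise reduction mod $p$, and set $$I(z)=\sum_{\text{independent }\{j_1<\dots<j_k\}}[I]^{l_1p-1,\dots,l_kp-1}_{j_1,\dots,j_k}(z,q,A)\,F(j_1,\dots,j_k)\in V\otimes\mathbb F_p[z_1,\dots,z_n].$$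 Then $I(z)$ satisfies the singular vector equations (with respect to the weights $a$) identically in $z$, and it satisfies the Gauss–Manin differential equations over $\mathbb F_p$: $$[\kappa]\frac{\partial I}{\partial z_i}(z)=[K]_i(z)\,I(z),\qquad i\in J.$$
   Context: Setting. Let $k<n$ be positive integers and $J=\{1,\dots,n\}$. Fix integers $b^i_j$ ($j\in J$, $i=1,\dots,k$) such that each linear form $g_j(t)=\sum_{i=1}^k b^i_jt_i$ is nonzero and $g_1,\dots,g_n$ span a $k$-dimensional space. Put $f_j(z,t)=z_j+g_j(t)$, a polynomial in $z=(z_1,\dots,z_n)$, $t=(t_1,\dots,t_k)$. A circuit is a subset $C\subset J$ such that $(g_i)_{i\in C}$ are linearly dependent over $\mathbb C$ but every proper subset of $C$ gives linearly independent forms; $\mathfrak C$ denotes the set of circuits. For each circuit $C$ fix integers $(\lambda^i_C)_{i\in J}$, not all zero, with $\lambda^i_C=0$ for $i\notin C$, $\sum_{i\in J}\lambda^i_Cg_i=0$ and $\gcd_i(\lambda^i_C)=1$, and put $f_C(z)=\sum_{i\in J}\lambda^i_Cz_i$. For a prime $p$, $[\cdot]:\mathbb Z\to\mathbb F_p$ is reduction mod $p$, applied coefficientwise to polynomials; $[g]_j$, $[f]_j=z_j+[g]_j$, $[f]_C$ are the reductions. The prime $p$ is called good if all $[g]_j$, $[f]_j$ ($j\in J$) and $[f]_C$ ($C\in\mathfrak C$) are nonzero and the circuits of $([g]_j)_{j\in J}$ over $\mathbb F_p$ (minimal $\mathbb F_p$-linearly dependent subsets) are exactly the elements of $\mathfrak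 C$. A $k$-element subset $\{j_1,\dots,j_k\}\subset J$ is independent if $g_{j_1},\dots,g_{j_k}$ are linearly independent. Put $d_{j_1,\dots,j_k}=\det_{i,l=1}^k(b^i_{j_l})$. The space $V$: the $\mathbb F_p$-vector space with basis $F(j_1,\dots,j_k)$ indexed by independent subsets $\{j_1<\dots<j_k\}$; for any permutation $\sigma$ set $F(j_{\sigma(1)},\dots,j_{\sigma(k)})=\mathrm{sgn}(\sigma)F(j_1,\dots,j_k)$. Singular vector equations: for $v=\sum I_{j_1,\dots,j_k}F(j_1,\dots,j_k)$ (sum over independent increasing tuples), extend the coefficients to all $(j_1,\dots,j_k)\in J^k$ by skew-symmetry in the indices and by $I_{j_1,\dots,j_k}=0$ if the entries are not distinct or do not form an independent set. Then $v$ satisfies the singular vector equations if $\sum_{j\in J}[a_j]I_{j,j_2,\dots,j_k}=0$ for all $j_2,\dots,j_k\in J$. Operators $[L]_C$: for a circuit $C=\{i_1<\dots<i_r\}$ and $C_m=C\setminus\{i_m\}$, define $[L]_C$ on basis vectors: $[L]_CF(j_1,\dots,j_k)=0$ if $|\{j_1,\dots,j_k\}\cap C|<r-1$; if $\{j_1,\dots,j_k\}\cap C=C_m$, write $\{j_1,\dots,j_k\}\setminus C_m=\{s_1,\dots,s_{k-r+1}\}$ and set (extending linearly using the sign rule) $$[L]_C F(i_1,\dots,\widehat{i_m},\dots,i_r,s_1,\dots,s_{k-r+1})=(-1)^m\sum_{l=1}^r(-1)^l[a_{i_l}]F(i_1,\dots,\widehat{i_l},\dots,i_r,s_1,\dots,s_{k-r+1}).$$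 Geometric Hamiltonians: $[K]_i(z)=\sum_{C\in\mathfrak C}\frac{[\lambda^i_C]}{[f]_C(z)}[L]_C$, $i\in J$, rational functions in $z$ with values in $\mathrm{End}(V)$. Derivatives in $z$ are formal. *)

(* Defs.v *)
From HB Require Import structures.
From mathcomp Require Import all_boot all_order all_algebra all_field.
From mathcomp Require Import fraction.
From mathcomp Require Import mpoly.

Set Implicit Arguments.
Unset Strict Implicit.
Unset Printing Implicit Defensive.

Import Order.TTheory GRing.Theory Num.Theory.
Local Open Scope ring_scope.

Section Defs.
Variables (n k : nat) (b : 'I_k -> 'I_n -> int).

Definition gpoly (R : nzRingType) (j : 'I_n) : {mpoly R[k]} :=
  \sum_(i < k) (b i j)%:~R *: 'X_i.

Definition grow (F : fieldType) (j : 'I_n) : 'rV[F]_k := \row_i (b i j)%:~R.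

Definition indepF (F : fieldType) (S : {set 'I_n}) : bool :=
  free [seq grow F j | j <- enum S].

Definition circuitF (F : fieldType) (C : {set 'I_n}) : bool :=
  ~~ indepF F C && [forall T : {set 'I_n}, (T \proper C) ==> indepF F T].

Definition indep := indepF algC.
Definition circuit := circuitF algC.

Definition spans_k : bool :=
  \dim (span [seq grow algC j | j <- enum 'I_n]) == k.

Definition lambda_ok (lam : {set 'I_n} -> 'I_n -> int) (C : {set 'I_n}) : Prop :=
  [/\ exists i, lam C i != 0,
      forall i, i \notin C -> lam C i = 0,
      \sum_(i < n) lam C i *: gpoly int i = 0
    & (\big[gcdn/0%N]_(i < n) `|lam C i|%N)%N = 1%N].

Definition fpoly (R : nzRingType) (j : 'I_n) : {mpoly {mpoly R[n]}[k]} :=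
  ('X_j)%:MP + \sum_(i < k) (b i j)%:~R * 'X_i.

Definition fCpoly (R : nzRingType) (lam : {set 'I_n} -> 'I_n -> int)
  (C : {set 'I_n}) : {mpoly R[n]} :=
  \sum_(i < n) (lam C i)%:~R *: 'X_i.

Definition good_prime (p : nat) (lam : {set 'I_n} -> 'I_n -> int) : Prop :=
  [/\ forall j, gpoly 'F_p j != 0,
      forall j, fpoly 'F_p j != 0,
      forall C, circuit C -> fCpoly 'F_p lam C != 0
    & forall C, circuitF 'F_p C = circuit C].

Definition basisS (S : {set 'I_n}) : bool := (#|S| == k) && indep S.

Fixpoint ninv (w : seq 'I_n) : nat :=
  match w with
  | [::] => 0%N
  | x :: w' => (count (fun y : 'I_n => (y < x)%N) w' + ninv w')%N
  end.

Definition sgn_seq (R : nzRingType) (w : seq 'I_n) : R := (-1) ^+ ninv w.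

(* elements of V (tensored with R) are represented by their coefficient
   functions on subsets S of J; the coefficient at S is the coordinate along
   the basis vector F(S) = F(j_1 < ... < j_k) (only independent k-subsets
   index basis vectors). *)

Definition Fseq (R : nzRingType) (w : seq 'I_n) : {ffun {set 'I_n} -> R} :=
  [ffun T => if [&& uniq w, size w == k, indep [set x in w] & T == [set x in w]]
             then sgn_seq R w else 0].

Definition coef_ext (R : nzRingType) (v : {ffun {set 'I_n} -> R}) (w : seq 'I_n) : R :=
  if uniq w && indep [set x in w] then sgn_seq R w * v [set x in w] else 0.

Definition singular_eqs (R : nzRingType) (a : 'I_n -> R) (v : {ffun {set 'I_n} -> R}) : Prop :=
  forall t : (k.-1).-tuple 'I_n,
    \sum_(j < n) a j * coef_ext v (j :: t) = 0.

(* the operator L_C on a basis vector F(S): with c = (i_1 < ... < i_r) the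
   elements of C and s = (s_1 < ...) those of S \ C, if S :&: C = C \ {y}
   (y = i_m) then F(S) = sgn(C_m, s) F(C_m, s) and
   L_C F(C_m, s) = (-1)^m sum_l (-1)^l a_{i_l} F(C_l, s);
   otherwise L_C F(S) = 0.  (index is 0-based; (-1)^(m+l) is unchanged.) *)
Definition LC_basis (R : comNzRingType) (a : 'I_n -> R) (C S : {set 'I_n}) :
  {ffun {set 'I_n} -> R} :=
  let c := enum C in let s := enum (S :\: C) in
  [ffun T => \sum_(y <- c | S :&: C == C :\ y)
     (sgn_seq R (rem y c ++ s) * (-1) ^+ (index y c)) *
       \sum_(x <- c) ((-1) ^+ (index x c) * a x) * Fseq R (rem x c ++ s) T].

Definition LC (R : comNzRingType) (a : 'I_n -> R) (C : {set 'I_n})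
  (v : {ffun {set 'I_n} -> R}) : {ffun {set 'I_n} -> R} :=
  [ffun T => \sum_(S : {set 'I_n} | basisS S) v S * LC_basis a C S T].

Definition dS (S : {set 'I_n}) : int :=
  \det (\matrix_(i < k, l < k) oapp (b i) 0 (onth (enum S) l)).

(* X_{j_1..j_k}(z,t,A) = (prod_j f_j^{A_j}) d / prod_l f_{j_l}
   (the exact quotient, written as a polynomial) *)
Definition Xpoly (A : 'I_n -> nat) (S : {set 'I_n}) : {mpoly {mpoly int[n]}[k]} :=
  (dS S)%:~R * \prod_(j < n) fpoly int j ^+ (A j - (j \in S)).

Definition shift (q : 'I_k -> int) : k.-tuple {mpoly {mpoly int[n]}[k]} :=
  [tuple 'X_i + (q i)%:~R | i < k].

Definition Itaylor (A : 'I_n -> nat) (q : 'I_k -> int) (S : {set 'I_n})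
  (m : 'X_{1..k}) : {mpoly int[n]} :=
  (Xpoly A S \mPo shift q)@_m.

Definition Ivec (p : nat) (A : 'I_n -> nat) (q : 'I_k -> int) (l : 'I_k -> nat) :
  {ffun {set 'I_n} -> {mpoly 'F_p[n]}} :=
  [ffun S => if basisS S then
      map_mpoly (fun x : int => (x%:~R : 'F_p))
        (Itaylor A q S [multinom (l i * p).-1 | i < k])
    else 0].

End Defs.

Notation "x %:F" := (@FracField.tofrac _ x) : ring_scope.

(* Main.v *)
(* Taking the coefficient of (t - q)^(l p - 1) is linear over F_p[z], commutes
   with the z-derivatives, and kills every t-derivative, since the exponents are
   -1 mod p.  With Phi = prod_j f_j^(A_j):
   - Expanding a determinant along its first column turns the singular vector
     equation for (j_2, .., j_k) into a constant-coefficient t-derivative of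
     Phi / (f_{j_2} .. f_{j_k}).
   - If C is a circuit with C \ x inside a basis S and x outside S, then
     f_C = sum_j lambda_C^j f_j, and Cramer's rule for the relation lambda_C gives
     f_C (a_x d_S Phi / (f_x f_S)) = lambda_C^x (L_C X)_S before any coefficient
     is taken.
   - Circuits contributing to the S-component are exactly the fundamental circuits
     of the elements x outside S.  Hence for i outside S only the circuit of i
     contributes, and for i in S the equation is the t-derivative of Phi / f_S
     along the constant vector field on which g_i is 1 and the other g_j, j in S,
     are 0. *)
Require Import Defs.
From HB Require Import structures.
From mathcomp Require Import all_boot all_order all_algebra all_field.
From mathcomp Require Import fraction.
From mathcomp Require Import mpoly.
From mathcomp Require Import ring.
Import GRing.Theory.
Local Open Scope ring_scope.

Set Implicit Arguments.
Unset Strict Implicit.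
Unset Printing Implicit Defensive.

(** * Alternating functions of sequences and the sign of sorting *)

Section Alternating.
Variable n : nat.

Local Notation ltI := (fun x y : 'I_n => (x < y)%N).

Lemma sorted_enum_ord (A : {set 'I_n}) : sorted ltI (enum A).
Proof.
rewrite [enum _]/(enum_mem _) sorted_filter //; first by move=> x y z; apply: ltn_trans.
by have := iota_ltn_sorted 0 n; rewrite -val_enum_ord sorted_map enumT.
Qed.

Lemma enum_set_seq_eq (A : {set 'I_n}) (s : seq 'I_n) :
  sorted ltI s -> s =i A -> s = enum A.
Proof.
move=> ss sA; apply: (irr_sorted_eq (leT := ltI)) => //.
- by move=> x y z; apply: ltn_trans.
- by move=> x; apply: ltnn.
- exact: sorted_enum_ord.
by move=> x; rewrite sA mem_enum.
Qed.

Variables (R : nzRingType) (m : nat) (f : seq 'I_n -> R).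
Hypothesis f_swap : forall u x y v, size (u ++ x :: y :: v) = m ->
  f (u ++ x :: y :: v) = - f (u ++ y :: x :: v).

Lemma alternating_move u x r v : size (u ++ x :: r ++ v) = m ->
  f (u ++ x :: r ++ v) = (-1) ^+ size r * f (u ++ r ++ x :: v).
Proof.
elim: r u => [|y r IHr] u /= sz; first by rewrite mul1r.
have szE : size (rcons u y ++ x :: r ++ v) = m.
  by rewrite -sz !size_cat size_rcons /= !size_cat !addnS addSn.
rewrite f_swap // -cat_rcons IHr // cat_rcons exprS -!mulrA mulN1r.
by congr (- _).
Qed.

(** Insertion sort: once the tail is sorted, the head [x] moves past exactly the tail entries
    smaller than [x], and their number is the first summand of [ninv]. *)
Lemma alternating_sgn_seq w : uniq w -> size w = m ->
  f w = sgn_seq R w * f (enum [set x in w]).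
Proof.
(* The prefix [u] collects the heads already removed, so that [f] is always evaluated at full length
   [m]. *)
suff H u : uniq w -> size (u ++ w) = m ->
    f (u ++ w) = sgn_seq R w * f (u ++ enum [set x in w]).
  by move=> uw sw; apply: (H [::]).
rewrite /sgn_seq; elim: w u => [|x w IHw] u /= => [_ _|/andP[xw uw] sz].
  rewrite mul1r; congr (f (u ++ _)); apply: enum_set_seq_eq => // x.
  by rewrite inE.
rewrite -cat_rcons IHw //; last by rewrite -sz cat_rcons.
move En: (enum [set y in w]) => s.
have mem_s y : (y \in s) = (y \in w) by rewrite -En mem_enum inE.
have us : uniq s by rewrite -En enum_uniq.
have ss : sorted ltI s by rewrite -En; apply: sorted_enum_ord.
have tr : transitive ltI.
  by move=> y z t; apply: ltn_trans.
(* The sorted tail is cut at the place where [x] is to be inserted. *)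
pose r1 := [seq y : 'I_n <- s | (y < x)%N]; pose r2 := [seq y : 'I_n <- s | (x < y)%N].
have sf P : sorted ltI [seq y : 'I_n <- s | P y] by apply: sorted_filter.
have sr12 : sorted ltI (r1 ++ x :: r2).
  rewrite sorted_pairwise // pairwise_cat /= -!sorted_pairwise //.
  rewrite !sf !andbT; apply/andP; split; last first.
    by apply/allP => y; rewrite mem_filter => /andP[].
  apply/allrelP => y z; rewrite mem_filter => /andP[yx _].
  rewrite inE mem_filter => /orP[/eqP-> //|/andP[xz _]].
  exact: ltn_trans xz.
have sE : s = r1 ++ r2.
  rewrite -En; symmetry; apply: enum_set_seq_eq => [|y].
    move: sr12; rewrite !sorted_pairwise // !pairwise_cat allrel_consr /=.
    by case/and4P=> /andP[_ ->] -> _ ->.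
  rewrite mem_cat !mem_filter mem_s inE -andb_orl.
  case: (boolP (y \in w)) => [yw|_]; last by rewrite andbF.
  by rewrite andbT -neq_ltn; apply: contraNneq xw => /val_inj <-.
have -> : f (rcons u x ++ s) = (-1) ^+ size r1 * f (u ++ r1 ++ x :: r2).
  rewrite sE cat_rcons alternating_move //.
  rewrite -sE -sz !size_cat /=; congr (_ + _.+1)%N.
  apply/perm_size/uniq_perm => //.
have -> : r1 ++ x :: r2 = enum [set y in x :: w].
  apply: enum_set_seq_eq => // y; rewrite !inE mem_cat !inE orbCA.
  by rewrite -[_ || (_ \in r2)]mem_cat -sE mem_s.
rewrite mulrA -exprD size_filter addnC; congr ((-1) ^+ (_ + _) * _).
by apply/permP/uniq_perm.
Qed.

End Alternating.

(** * Determinants of the coefficient matrix and linear independence *)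

Section Determinant.
Variables (n k : nat) (b : 'I_k -> 'I_n -> int).

(** On sequences of length [k] this is the skew-symmetric extension of [dS]; working with it avoids
    sorting after each exchange of indices. *)
Definition detb (w : seq 'I_n) : int :=
  \det (\matrix_(i < k, l < k) oapp (b i) 0 (onth w l)).

Lemma detb_swap u x y v : size (u ++ x :: y :: v) = k ->
  detb (u ++ x :: y :: v) = - detb (u ++ y :: x :: v).
Proof.
move=> sz; rewrite /detb.
have sz' : (size u + (size v).+2)%N = k by rewrite -sz size_cat.
have l1 : (size u < k)%N by rewrite -sz' -addSnnS leq_addr.
have l2 : ((size u).+1 < k)%N by rewrite -sz' -addSnnS -addSnnS leq_addr.
pose i1 := Ordinal l1; pose i2 := Ordinal l2.
have ne : i1 != i2 by rewrite -val_eqE /= neq_ltn ltnSn.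
rewrite (_ : \matrix_(i, l) _ = xcol i1 i2
  (\matrix_(i < k, l < k) oapp (b i) 0 (onth (u ++ y :: x :: v) l))).
  by rewrite xcolE det_mulmx det_perm perm.odd_tperm ne mulrN1.
apply/matrixP => i l; rewrite !mxE !onth_cat.
case: perm.tpermP => [->|->|/eqP n1 /eqP n2] /=.
- by rewrite ltnn subnn ltnNge leqnSn /= subSn // subnn.
- by rewrite ltnn subnn ltnNge leqnSn /= subSn // subnn.
case: ltnP => // le.
move: n1 n2; rewrite -!val_eqE /= => n1 n2.
have : ((size u).+2 <= l)%N.
  by rewrite ltn_neqAle eq_sym n2 ltn_neqAle eq_sym n1.
by move=> /subnKC <-; rewrite !addSn -!addnS addKn.
Qed.

Lemma detb_sgn_seq w : uniq w -> size w = k ->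
  detb w = sgn_seq int w * dS b [set x in w].
Proof. exact: alternating_sgn_seq detb_swap w. Qed.

Lemma detb_nuniq w : size w = k -> ~~ uniq w -> detb w = 0.
Proof.
case: w => [|x0 w'] // ; move: (x0 :: w') => w sz.
case/(uniqPn x0) => i [j [ij js e]].
have jk : (j < k)%N by rewrite -sz.
have ik : (i < k)%N by apply: ltn_trans jk.
rewrite /detb -det_tr.
apply: (@determinant_alternate _ _ _ (Ordinal ik) (Ordinal jk)).
  by rewrite -val_eqE /= neq_ltn ij.
move=> m; rewrite !mxE /=; congr (oapp (b m) 0 _).
by rewrite !onthE !(nth_map x0) ?e // (ltn_trans ij).
Qed.

(** After transposition the rows of the matrix are the vectors [grow b F j], and a vector in its
    left kernel is a linear relation between them. *)
Lemma detb_neq0 (F : fieldType) (w : seq 'I_n) : uniq w -> size w = k ->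
  ((detb w)%:~R != 0 :> F) = indepF b F [set x in w].
Proof.
move=> uw sz; rewrite /indepF.
have /perm_free -> : perm_eq [seq grow b F j | j <- enum [set x in w]]
                             [seq grow b F j | j <- w].
  by apply/perm_map/uniq_perm; rewrite ?enum_uniq // => x; rewrite mem_enum inE.
have /eqP szm : size [seq grow b F j | j <- w] = k by rewrite size_map.
pose X := Tuple szm.
have dE : (detb w)%:~R = \det (\matrix_(l < k) X`_l) :> F.
  rewrite -det_tr /detb -[LHS](det_map_mx (intr : {rmorphism int -> F})).
  congr (\det _); apply/matrixP => i l; rewrite !mxE.
  have: (l < size w)%N by rewrite sz.
  move=> lw; have x0 : 'I_n by case: (w) lw.
  by rewrite onthE !(nth_map x0) // mxE.
rewrite dE -[free _]/(free X); apply/idP/freeP => [nz c hc i|H].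
  apply/eqP; apply: contraNT nz => nzi; apply/det0P; exists (\row_l c l).
    by apply: contraNneq nzi => /rowP/(_ i); rewrite !mxE => ->.
  rewrite mulmx_sum_row -[RHS]hc; apply: eq_bigr => l _.
  by rewrite mxE rowK.
apply/det0P => -[v /eqP nzv vA]; apply: nzv; apply/rowP => l; rewrite mxE.
apply: (H (fun l => v 0 l)); rewrite -[RHS]vA mulmx_sum_row.
by apply: eq_bigr => m _; rewrite rowK.
Qed.

(** Relations become functions on all of J supported in [S], which is the form in which [lam] is
    given. *)
Lemma indepFP (F : fieldType) (S : {set 'I_n}) :
  reflect (forall c : 'I_n -> F, (forall i, i \notin S -> c i = 0) ->
             \sum_i c i *: grow b F i = 0 -> forall i, c i = 0)
          (indepF b F S).
Proof.
rewrite /indepF.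
have /eqP szm : size [seq grow b F j | j <- enum S] = #|S|.
  by rewrite size_map cardE.
have nthE (l : 'I_#|S|) : (Tuple szm)`_l = grow b F (enum_val l).
  rewrite /= (nth_map (enum_val l)); last by rewrite -cardE.
  by rewrite -enum_val_nth.
have sumE (c : 'I_n -> F) : (forall i, i \notin S -> c i = 0) ->
    \sum_i c i *: grow b F i = \sum_(l < #|S|) c (enum_val l) *: (Tuple szm)`_l.
  move=> cS; rewrite (bigID (mem S)) /= [X in _ + X]big1 ?addr0; last first.
    by move=> i /cS ->; rewrite scale0r.
  by rewrite big_enum_val; apply: eq_bigr => l _; rewrite nthE.
rewrite -[map _ _]/(tval (Tuple szm)).
apply: (iffP freeP) => H c cS.
  rewrite sumE // => /H c0 i; case: (boolP (i \in S)) => [iS|/cS //].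
  by rewrite -(enum_rankK_in iS iS) c0.
(* The coefficients [c], indexed by positions in [enum S], are extended by 0 to J; the match
   produces the membership proof that [enum_rank_in] asks for. *)
move=> i.
pose d j := if (j \in S) =P true is ReflectT jS then c (enum_rank_in jS j) else 0.
have dE l : d (enum_val l) = c l.
  rewrite /d; case: eqP => [jS|/negP]; last by rewrite enum_valP.
  by rewrite enum_valK_in.
have d0 j : j \notin S -> d j = 0.
  by move=> njS; rewrite /d; case: eqP => // jS; case/negP: njS.
rewrite -dE; apply: H => //; rewrite sumE //.
by rewrite -[RHS]cS; apply: eq_bigr => l _; rewrite dE.
Qed.

Lemma indepFS (F : fieldType) (S T : {set 'I_n}) :
  S \subset T -> indepF b F T -> indepF b F S.
Proof.
move=> /subsetP ST /indepFP H; apply/indepFP => c cS; apply: H => i iT.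
by apply: cS; apply: contra iT => /ST.
Qed.

Lemma dependent_circuitF (F : fieldType) (S : {set 'I_n}) :
  ~~ indepF b F S -> exists2 C, circuitF b F C & C \subset S.
Proof.
move=> /(@minset_exists _ (fun S => ~~ indepF b F S)) [C /minsetP[nC minC] CS].
exists C => //; rewrite /circuitF nC; apply/forallP => T; apply/implyP => TC.
apply/negPn/negP => nT; move: (TC).
by rewrite (minC T nT (proper_sub TC)) properxx.
Qed.

(** A set is independent exactly when it contains no circuit. This carries independence from [algC]
    to the prime field of a good prime. *)
Lemma eq_indepF (F F' : fieldType) :
  (forall C, circuitF b F C = circuitF b F' C) ->
  forall S, indepF b F S = indepF b F' S.
Proof.
move=> eqC S; apply/idP/idP => iS; apply/negPn/negP => /dependent_circuitF[C];
  rewrite (eqC, =^~ eqC) => /andP[nC _] CS.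
- by rewrite (indepFS CS iS) in nC.
- by rewrite (indepFS CS iS) in nC.
Qed.

Lemma indepF_card (F : fieldType) (S : {set 'I_n}) :
  indepF b F S -> (#|S| <= k)%N.
Proof.
rewrite /indepF /free size_map -cardE => /eqP <-.
by rewrite (leq_trans (dimvS (subvf _))) // dimvf /dim /= mul1n.
Qed.

End Determinant.

(** * Formal derivatives of products of powers *)

(** The abstract [d] covers both the t-derivatives and the coefficientwise z-derivative [zderiv].
    Truncation in [e j - (j == x)] is harmless: it occurs only when [e x = 0], and then the factor
    [*+ e x] kills the term. *)
Lemma leibniz_prod (T : comNzRingType) (d : T -> T) (I : finType)
    (h : I -> T) (e : I -> nat) :
  (forall x y, d (x * y) = d x * y + x * d y) ->
  d (\prod_j h j ^+ e j) =
  \sum_x (d (h x) *+ e x) * \prod_j h j ^+ (e j - (j == x)).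
Proof.
move=> dM.
have d1 : d 1 = 0.
  by have := dM 1 1; rewrite !mulr1 mul1r -[LHS]addr0 => /addrI.
have dX y m : d (y ^+ m) = d y *+ m * y ^+ m.-1.
  elim: m => [|m IHm]; first by rewrite expr0 d1 mulr0n mul0r.
  rewrite exprS dM IHm mulrS mulrDl; congr (_ + _).
  case: m {IHm} => [|m]; first by rewrite !mul0r mulr0.
  by rewrite mulrCA exprS.
have dprod (G : I -> T) (s : seq I) : uniq s ->
    d (\prod_(j <- s) G j) = \sum_(x <- s) d (G x) * \prod_(j <- s | j != x) G j.
  elim: s => [|y s IHs] /=; first by rewrite !big_nil.
  move=> /andP[ys us]; rewrite !big_cons eqxx /= dM IHs //; congr (_ * _ + _).
    rewrite big_seq [RHS]big_seq_cond; apply: eq_bigl => j.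
    by case: eqVneq => [->|]; rewrite ?(negbTE ys) ?andbT.
  rewrite mulr_sumr !big_seq; apply: eq_bigr => x xs.
  rewrite big_cons; have -> : y != x by apply: contraNneq ys => ->.
  by rewrite mulrCA.
rewrite dprod ?index_enum_uniq //; apply: eq_bigr => x _.
rewrite dX -mulrA; congr (_ * _); rewrite [RHS](bigD1 x) //= eqxx subn1.
by congr (_ * _); apply: eq_bigr => j /negbTE ->; rewrite subn0.
Qed.

Lemma mderivXU (m : nat) (S : nzRingType) (i j : 'I_m) :
  ('X_i : {mpoly S[m]})^`M(j) = (i == j)%:R.
Proof.
rewrite mderivX mnm1E; case: eqVneq => [->|_]; last by rewrite scale0r.
by rewrite scale1r -{1}[U_(j)%MM]add0m addmK mpolyX0.
Qed.

Lemma mderiv_int (S : nzRingType) (m : nat) i (z : int) :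
  (z%:~R : {mpoly S[m]})^`M(i) = 0.
Proof. by rewrite -(rmorph_int (@mpolyC m S)) mderivC. Qed.

(** * Taylor coefficients of products of the affine forms *)

Section TaylorForms.
Variables (n k : nat) (b : 'I_k -> 'I_n -> int) (q : 'I_k -> int).

Lemma gpoly_relation (lam : 'I_n -> int) :
  \sum_j lam j *: gpoly b int j = 0 -> forall i, \sum_j lam j * b i j = 0.
Proof.
move=> /(congr1 (fun P => P@_U_(_))) rel i; move: (rel i).
rewrite mcoeff0 raddf_sum /= => {2}<-; apply: eq_bigr => j _.
rewrite mcoeffZ /gpoly raddf_sum /= (bigD1 i) //= big1 => [|l li].
  by rewrite mcoeffZ mcoeffX eqxx mulr1 addr0 intz.
rewrite mcoeffZ mcoeffX [_ == _](_ : _ = false) ?mulr0 //.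
apply/eqP => /mnmP/(_ i); rewrite !mnm1E eqxx (negbTE li) //.
Qed.

(* The affine forms f_j in the Taylor coordinates t - q. *)
Definition hpoly (F : nzRingType) (j : 'I_n) : {mpoly {mpoly F[n]}[k]} :=
  ('X_j + (\sum_i b i j * q i)%:~R)%:MP +
  \sum_i ((b i j)%:~R : {mpoly F[n]}) *: 'X_i.

Lemma fpoly_shift j : fpoly b int j \mPo shift n q = hpoly int j.
Proof.
rewrite /fpoly /hpoly comp_mpolyD comp_mpolyC mpolyCD -addrA; congr (_ + _).
rewrite !rmorph_sum /= -big_split; apply: eq_bigr => i _ /=.
rewrite !rmorphM /= rmorph_int comp_mpolyXU -tnth_nth tnth_mktuple mulrDr addrC.
congr (_ + _); last by rewrite !(rmorph_int (@mpolyC k {mpoly int[n]})).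
by rewrite -mul_mpolyC (rmorph_int (@mpolyC k {mpoly int[n]})).
Qed.

Variable F : comNzRingType.
Local Notation R := {mpoly F[n]}.

Lemma map_hpoly (f : {rmorphism int -> F}) j :
  map_mpoly (map_mpoly f) (hpoly int j) = hpoly F j :> {mpoly R[k]}.
Proof.
rewrite /hpoly rmorphD /= map_mpolyC; congr (_ %:MP + _).
  by rewrite -[LHS]/(map_mpoly f _) rmorphD /= map_mpolyX rmorph_int.
by rewrite rmorph_sum; apply: eq_bigr => i _ /=; rewrite map_mpolyZ rmorph_int map_mpolyX.
Qed.

Lemma mderiv_hpoly m j : (hpoly F j)^`M(m) = ((b m j)%:~R)%:MP.
Proof.
rewrite /hpoly mderivD mderivC add0r raddf_sum /= (bigD1 m) //= big1 => [|i im].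
  by rewrite mderivZ mderivXU eqxx addr0 -mul_mpolyC mulr1.
by rewrite mderivZ mderivXU (negbTE im) scaler0.
Qed.

Definition zderiv (i : 'I_n) (P : {mpoly R[k]}) : {mpoly R[k]} :=
  map_mpoly (mderiv i) P.

Lemma mcoeff_zderiv i P m : (zderiv i P)@_m = (P@_m)^`M(i).
Proof. by rewrite /zderiv mcoeff_map_mpoly. Qed.

Lemma zderivM i P Q : zderiv i (P * Q) = zderiv i P * Q + P * zderiv i Q.
Proof.
apply/mpolyP => m; rewrite mcoeff_zderiv mcoeffD !mcoeffM raddf_sum -big_split.
by apply: eq_bigr => l _; rewrite !mcoeff_zderiv /= mderivM.
Qed.

Lemma zderiv_hpoly i j : zderiv i (hpoly F j) = (i == j)%:R.
Proof.
apply/mpolyP => m; rewrite mcoeff_zderiv /hpoly mcoeffD mcoeffC (raddf_sum (mcoeff m)) /=.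
have -> : \sum_i0 ((b i0 j)%:~R *: 'X_i0)@_m =
    (\sum_i0 (b i0 j * (U_(i0)%MM == m))) %:~R :> R.
  rewrite rmorph_sum; apply: eq_bigr => l _ /=.
  by rewrite mcoeffZ mcoeffX rmorphM /=; case: (_ == m).
rewrite mderivD mderiv_int addr0 mcoeffMn mcoeff1 -mulr_natr.
case: (m == 0%MM); last by rewrite !mulr0 mul0rn raddf0.
by rewrite !mulr1 mderivD mderiv_int addr0 mderivXU eq_sym.
Qed.

Variable m : 'X_{1..k}.
Hypothesis m_char : forall i, (m i).+1%:R = 0 :> F.

Lemma mcoeff_mderiv0 i (P : {mpoly R[k]}) : (P^`M(i))@_m = 0.
Proof.
rewrite mcoeff_deriv -mulr_natr -(rmorph_nat (@mpolyC n F)) m_char.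
by rewrite raddf0 mulr0.
Qed.

(** All quotients of the master polynomial that occur below are products of powers of the forms, so
    only the exponents [e] have to be tracked and no division is performed. *)
Definition hprod (e : 'I_n -> nat) : R := (\prod_j hpoly F j ^+ e j)@_m.

(** Among the forms only the one with index [i] contains z_i, and its derivative is 1. *)
Lemma mderiv_hprod i e :
  (hprod e)^`M(i) = (e i)%:R * hprod (fun j => e j - (j == i))%N.
Proof.
rewrite /hprod -mcoeff_zderiv (leibniz_prod _ _ (zderivM i)) (bigD1 i) //=.
rewrite [X in _ + X]big1 => [|x xi]; last first.
  by rewrite zderiv_hpoly eq_sym (negbTE xi) mul0rn mul0r.
by rewrite addr0 zderiv_hpoly eqxx /= [X in X@__ = _]mulr_natl mcoeffMn mulr_natl.
Qed.

(* The left-hand side is the coefficient of the derivative of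
   [\prod_j hpoly F j ^+ e j] along the constant vector field [c]. *)
Lemma hprod_exact (c : 'I_k -> int) e :
  \sum_x (e x)%:R * (\sum_i b i x * c i)%:~R *
    hprod (fun j => e j - (j == x))%N = 0.
Proof.
(* The case of a coordinate direction; a general [c] follows by linearity. *)
have H i : \sum_x (e x)%:R * (b i x)%:~R * hprod (fun j => e j - (j == x))%N = 0.
  rewrite -[RHS](mcoeff_mderiv0 i (\prod_j hpoly F j ^+ e j)).
  rewrite (leibniz_prod _ _ (@mderivM _ _ i)) raddf_sum; apply: eq_bigr => x _.
  rewrite /= mderiv_hpoly [in RHS]mulrnAl mcoeffMn mcoeffCM.
  by rewrite -[RHS]mulr_natl mulrA.
transitivity (\sum_i (c i)%:~R *
    \sum_x (e x)%:R * (b i x)%:~R * hprod (fun j => e j - (j == x))%N); last first.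
  by apply: big1 => i _; rewrite H mulr0.
under [RHS]eq_bigr => i _ do rewrite mulr_sumr.
rewrite exchange_big; apply: eq_bigr => x _ /=.
rewrite rmorph_sum mulr_sumr mulr_suml; apply: eq_bigr => i _ /=.
by rewrite rmorphM /= !mulrA; congr (_ * _); rewrite mulrC mulrA.
Qed.

(** The combination splits into a z-part, a constant coming from the shift by [q], and a t-part; the
    relation between the g_j kills the last two. *)
Lemma fC_hpoly (lam : {set 'I_n} -> 'I_n -> int) C :
  \sum_j lam C j *: gpoly b int j = 0 ->
  (fCpoly F lam C)%:MP = \sum_j ((lam C j)%:~R)%:MP * hpoly F j.
Proof.
move=> /gpoly_relation rel.
have -> : \sum_j ((lam C j)%:~R)%:MP * hpoly F j =
  \sum_j ((lam C j)%:~R * 'X_j)%:MP +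
  (\sum_i (\sum_j lam C j * b i j) * q i)%:~R%:MP +
  \sum_i ((\sum_j lam C j * b i j)%:~R)%:MP * 'X_i :> {mpoly R[k]}.
  under eq_bigr => j _ do rewrite /hpoly mulrDr -mpolyCM mulrDr mpolyCD.
  rewrite !big_split /=; congr (_ + _ + _).
    rewrite -rmorph_sum /=; congr (_ %:MP).
    under eq_bigr => j _ do rewrite -intrM mulr_sumr.
    rewrite -rmorph_sum exchange_big /=; congr (_ %:~R).
    by apply: eq_bigr => i _; rewrite mulr_suml; apply: eq_bigr => j _; rewrite mulrA.
  under eq_bigr => j _ do rewrite mulr_sumr.
  rewrite exchange_big /=; apply: eq_bigr => i _.
  rewrite rmorph_sum /= rmorph_sum mulr_suml; apply: eq_bigr => j _ /=.
  by rewrite intrM mpolyCM -mulrA !mul_mpolyC.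
rewrite [X in X%:~R%:MP](_ : _ = 0); last by apply: big1 => i _; rewrite rel mul0r.
rewrite mulr0z mpolyC0 addr0 [X in _ + X]big1 => [|i _]; last first.
  by rewrite rel mulr0z mpolyC0 mul0r.
rewrite addr0 /fCpoly rmorph_sum /=; apply: eq_bigr => j _; congr (_ %:MP).
by rewrite -mul_mpolyC rmorph_int.
Qed.

(** Since f_C is free of t it passes through the coefficient at [m], and each summand of [fC_hpoly]
    raises one exponent by 1. *)
Lemma fC_hprod (lam : {set 'I_n} -> 'I_n -> int) C e :
  \sum_j lam C j *: gpoly b int j = 0 ->
  fCpoly F lam C * hprod e =
  \sum_j (lam C j)%:~R * hprod (fun i => e i + (i == j))%N.
Proof.
move=> rel; rewrite /hprod -mcoeffCM (fC_hpoly rel) mulr_suml raddf_sum.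
apply: eq_bigr => j _; rewrite /= -mulrA mcoeffCM; congr (_ * _@__).
under [RHS]eq_bigr => i _ do rewrite exprD.
rewrite big_split /= mulrC; congr (_ * _).
rewrite (bigD1 j) //= eqxx big1 ?mulr1 // => i /negbTE ->.
by rewrite expr0.
Qed.

End TaylorForms.

(** * Cramer's rule for an integral relation between the forms *)

Lemma rem_cat_cons (T : eqType) (x : T) (s1 s2 : seq T) :
  x \notin s1 -> rem x (s1 ++ x :: s2) = s1 ++ s2.
Proof.
elim: s1 => [|y s1 IHs] /=; first by rewrite eqxx.
by rewrite inE negb_or eq_sym => /andP[/negbTE -> /IHs ->].
Qed.

Section Exchange.
Variables (n k : nat) (b : 'I_k.+1 -> 'I_n -> int).

Lemma detb_cons w : exists c : 'I_k.+1 -> int,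
  forall j, detb b (j :: w) = \sum_i b i j * c i.
Proof.
(* The coefficients are the cofactors of the first column. They do not see that column, so it is
   filled with zeros, and [l.-1] accounts for the place taken by [j]. *)
pose M := \matrix_(i < k.+1, l < k.+1)
  if l == ord0 then 0 else oapp (b i) 0 (onth w l.-1).
exists (fun i => cofactor M i ord0) => j.
rewrite /detb (expand_det_col _ ord0); apply: eq_bigr => i _.
rewrite mxE; congr (_ * (_ * \det _)).
by apply/matrixP => r l; rewrite !mxE.
Qed.

Variable lam : 'I_n -> int.
Hypothesis lam_rel : \sum_j lam j *: gpoly b int j = 0.

Lemma detb_relation w : \sum_j lam j * detb b (j :: w) = 0.
Proof.
have [c cE] := detb_cons w.
under eq_bigr => j _ do rewrite cE mulr_sumr.
rewrite exchange_big big1 //= => i _.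
under eq_bigr => j _ do rewrite mulrA.
by rewrite -mulr_suml (gpoly_relation lam_rel) mul0r.
Qed.

(** In [detb_relation] every term other than those of [x] and [y] has coefficient 0 or repeats an
    entry of [w]. *)
Lemma detb_relation2 x y w : x != y -> size w = k ->
  (forall j, lam j != 0 -> j \in [:: x, y & w]) ->
  lam y * detb b (y :: w) = - (lam x * detb b (x :: w)).
Proof.
move=> xy sz supp; apply/eqP; rewrite -addr_eq0; apply/eqP.
rewrite -[RHS](detb_relation w) (bigD1 y) //= (bigD1 x) //= big1 ?addr0 //.
move=> j /andP[jy jx].
have [->|/supp] := eqVneq (lam j) 0; first by rewrite mul0r.
rewrite !inE (negbTE jx) (negbTE jy) /= => jw.
by rewrite detb_nuniq ?mulr0 //= ?sz // jw.
Qed.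

(** Let [x] precede [y] in [c], and let [w] be [c ++ s] without both. Bringing the remaining one of
    the two to the front of [w] reduces the claim to [detb_relation2]; the minus sign there is
    absorbed because [index y c] also counts [x], which is absent from [w]. *)
Lemma detb_rem c s x y : uniq c -> x \in c -> y \in c ->
  (size c + size s = k.+2)%N -> (forall j, j \notin c -> lam j = 0) ->
  lam y * ((-1) ^+ index x c * detb b (rem x c ++ s)) =
  lam x * ((-1) ^+ index y c * detb b (rem y c ++ s)).
Proof.
wlog: x y / (index x c < index y c)%N.
  move=> H uc xc yc sz supp.
  case: (ltngtP (index x c) (index y c)) => [lt|lt|e]; first exact: H.
    by symmetry; apply: H.
  by rewrite -(nth_index x xc) e (nth_index x yc).
move=> lt uc xc yc sz supp.
have xy : x != y by apply: contraTneq lt => ->; rewrite ltnn.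
case/splitPr: xc uc yc sz lt supp => c1 c2' uc yc sz lt supp.
have yc2 : y \in c2'.
  move: yc; rewrite mem_cat inE eq_sym (negbTE xy) /= => /orP[yc1|//].
  move: lt uc; rewrite !index_cat yc1; case: ifP => [xc1|_].
    by rewrite cat_uniq /= xc1 orTb andbF.
  by rewrite ltnNge (leq_trans _ (leq_addr _ _)) // ltnW // index_mem.
case/splitPr: yc2 uc yc sz lt supp => c2 c3 uc yc sz lt supp.
have [xc1 yc1] : x \notin c1 /\ y \notin c1.
  move: uc; rewrite cat_uniq => /and3P[_ /hasPn H _].
  by split; apply: H; rewrite !inE ?eqxx // mem_cat inE eqxx !orbT.
have [xc2 yc2] : x \notin c2 /\ y \notin c2.
  move: uc; rewrite cat_uniq /= => /and4P[_ _ xH]; rewrite cat_uniq.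
  case/and3P=> _ /hasPn/(_ y (mem_head _ _)) yc2 _; split=> //.
  by apply: contra xH; rewrite mem_cat => ->.
have remx : rem x (c1 ++ x :: c2 ++ y :: c3) = c1 ++ c2 ++ y :: c3.
  by rewrite rem_cat_cons.
have remy : rem y (c1 ++ x :: c2 ++ y :: c3) = c1 ++ x :: c2 ++ c3.
  rewrite -[in LHS]cat_cons [in LHS]catA rem_cat_cons -?catA //.
  by rewrite mem_cat inE eq_sym (negbTE xy) (negbTE yc1).
have idx : index x (c1 ++ x :: c2 ++ y :: c3) = size c1.
  by rewrite index_cat (negbTE xc1) /= eqxx addn0.
have idy : index y (c1 ++ x :: c2 ++ y :: c3) = (size c1 + (size c2).+1)%N.
  rewrite index_cat (negbTE yc1) /= (negbTE xy) index_cat (negbTE yc2) /= eqxx.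
  by rewrite addn0.
rewrite remx remy idx idy -!catA /= -!catA.
pose w := c1 ++ c2 ++ c3 ++ s.
have szw : size w = k.
  move: sz; rewrite /w !size_cat /= size_cat /= !addnS !addSn => -[<-].
  by rewrite !addnA.
have mx : detb b (x :: w) = (-1) ^+ size c1 * detb b (c1 ++ x :: c2 ++ c3 ++ s).
  apply: (alternating_move (@detb_swap _ _ b) (u := [::])).
  by rewrite /= -/w szw.
have my : detb b (y :: w) =
    (-1) ^+ (size c1 + size c2) * detb b (c1 ++ c2 ++ y :: c3 ++ s).
  rewrite -size_cat /w [c1 ++ c2 ++ y :: _]catA [c1 ++ c2 ++ c3 ++ _]catA.
  apply: (alternating_move (@detb_swap _ _ b) (u := [::])).
  by rewrite /= -catA -/w szw.
have := detb_relation2 xy szw; rewrite mx my => rel2.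
set e1 := (-1) ^+ size c1 in rel2 *.
have e2 : (-1) ^+ size c2 * (-1) ^+ size c2 = 1 :> int by rewrite -expr2 sqrr_sign.
rewrite exprD exprS; rewrite exprD in rel2.
set s2 := (-1) ^+ size c2 in e2 rel2 *; rewrite -/e1 in rel2 *.
(* Inserting the square of a sign creates the product to which [rel2] applies. *)
transitivity ((s2 * s2) * (lam y * (e1 * detb b (c1 ++ c2 ++ y :: c3 ++ s)))).
  by rewrite e2 mul1r.
transitivity (s2 * (lam y * (e1 * s2 * detb b (c1 ++ c2 ++ y :: c3 ++ s)))).
  by ring.
rewrite rel2; first by ring.
move=> j nz; have : j \in c1 ++ x :: c2 ++ y :: c3.
  by apply: contraNT nz => /supp ->.
rewrite /w !(mem_cat, inE) => /orP[->|/orP[->|/orP[->|/orP[->|->]]]];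
  by rewrite ?orbT.
Qed.

End Exchange.

(** * Coordinates of the circuit operators *)

Section CircuitOperator.
Variables (n k : nat) (b : 'I_k -> 'I_n -> int).
Implicit Types (C D S : {set 'I_n}).

Lemma set_rem_cat C D y :
  [set z in rem y (enum C) ++ enum D] = (C :\ y) :|: D.
Proof.
apply/setP => z; rewrite !inE mem_cat mem_enum mem_rem_uniq ?enum_uniq //.
by rewrite inE mem_enum.
Qed.

Lemma uniq_rem_cat C S y : uniq (rem y (enum C) ++ enum (S :\: C)).
Proof.
rewrite cat_uniq rem_uniq ?enum_uniq //= andbT; apply/hasPn => z.
rewrite mem_enum inE => /andP[zC _]; apply: contra zC => /mem_rem.
by rewrite mem_enum.
Qed.

Variables (R : comNzRingType) (a : 'I_n -> R) (C : {set 'I_n}).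

(** Every basis vector in an image of L_C is some F(C_l, s) with s disjoint from [C], so its index
    set meets [C] in all but one element. *)
Lemma LC_eq0 (v : {ffun {set 'I_n} -> R}) S :
  (forall x, x \in C -> basisS b S -> S :&: C != C :\ x) ->
  LC b a C v S = 0.
Proof.
move=> H; rewrite ffunE big1 // => S' _; rewrite ffunE big1 ?mulr0 // => y _.
rewrite big_seq big1 ?mulr0 // => x; rewrite mem_enum => xC.
rewrite ffunE; case: ifP => [/and4P[uw sw iw /eqP SE]|]; last by rewrite mulr0.
have bS : basisS b S.
  rewrite /basisS SE iw andbT -(eqP sw) -(card_uniqP uw).
  by apply/eqP/eq_card => z; rewrite inE.
case/negP: (H x xC bS); rewrite SE set_rem_cat; apply/eqP/setP => z.
by rewrite !inE; case: (z \in C); rewrite ?andbF ?orbF ?andbT.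
Qed.

(** L_C keeps the part of an index set outside [C]. Hence [S] receives contributions only from the
    sets [(C :\ y) :|: (S :\: C)], and the newly omitted element must be [x]. *)
Lemma LC_coef (v : {ffun {set 'I_n} -> R}) S x :
  basisS b S -> x \in C -> S :&: C = C :\ x ->
  LC b a C v S = (-1) ^+ index x (enum C) * a x *
    sgn_seq R (rem x (enum C) ++ enum (S :\: C)) *
    \sum_(y <- enum C) (-1) ^+ index y (enum C) *
       coef_ext b v (rem y (enum C) ++ enum (S :\: C)).
Proof.
move=> bS xC SC; set K := _ * a x * _.
have Sx : (C :\ x) :|: (S :\: C) = S by rewrite -SC setID.
have cardY y : y \in C -> #|(C :\ y) :|: (S :\: C)| = k.
  move=> yC; case/andP: bS => /eqP Sk _; rewrite -[RHS]Sk -[in RHS]Sx.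
  rewrite !cardsU !disjoint_setI0 ?cards0 ?subn0; first last.
  - rewrite -setI_eq0; apply/eqP/setP => z.
    by rewrite !inE; case: (z \in C); rewrite ?andbF.
  - rewrite -setI_eq0; apply/eqP/setP => z.
    by rewrite !inE; case: (z \in C); rewrite ?andbF.
  congr (_ + _)%N; apply/eqP; rewrite -(eqn_add2l 1).
  by have := cardsD1 x C; have := cardsD1 y C; rewrite xC yC => <- <-.
(* A term F(C_l, s) lands on [S] only if it omits [x] and has the same part outside [C]. *)
have FE S' x' : x' \in C ->
    Fseq b R (rem x' (enum C) ++ enum (S' :\: C)) S =
    if (x' == x) && (S' :\: C == S :\: C)
    then sgn_seq R (rem x (enum C) ++ enum (S :\: C)) else 0.
  move=> x'C; rewrite ffunE uniq_rem_cat set_rem_cat /=.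
  case: (boolP (_ && (S' :\: C == _))) => [/andP[/eqP-> /eqP->]|ne].
    rewrite Sx eqxx andbT -(card_uniqP (uniq_rem_cat _ _ _)).
    rewrite (_ : #|_| = #|S|); first by case/andP: bS => -> ->.
    by apply: eq_card => z; rewrite -[in RHS]Sx -set_rem_cat inE.
  case: ifP => // /and3P[_ _ /eqP SE]; case/negP: ne; apply/andP; split.
    apply/eqP; move/setP/(_ x'): SC; rewrite SE !inE eqxx x'C /=.
    by rewrite andbT; case: eqVneq.
  apply/eqP/setP => z; rewrite [in RHS]SE !inE.
  by case: (z \in C); rewrite ?andbF.
transitivity (K * \sum_(y <- enum C) (-1) ^+ index y (enum C) *
    \sum_(S' | basisS b S' && ((S' :&: C == C :\ y) && (S' :\: C == S :\: C)))
       sgn_seq R (rem y (enum C) ++ enum (S :\: C)) * v S').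
  rewrite ffunE.
  under eq_bigr => S' _.
    rewrite ffunE (eq_bigr (fun y => if S' :\: C == S :\: C then
      K * ((-1) ^+ index y (enum C) *
        sgn_seq R (rem y (enum C) ++ enum (S :\: C))) else 0)); last first.
      move=> y _.
      have -> : \sum_(x0 <- enum C) (-1) ^+ index x0 (enum C) * a x0 *
          Fseq b R (rem x0 (enum C) ++ enum (S' :\: C)) S =
        if S' :\: C == S :\: C then K else 0.
        rewrite (bigD1_seq x) ?mem_enum ?enum_uniq //= big_seq_cond big1.
          by rewrite FE // eqxx /= addr0; case: ifP; rewrite ?mulr0.
        move=> x'; rewrite mem_enum => /andP[x'C /negbTE x'x].
        by rewrite FE // x'x mulr0.
      case: eqP => [->|_]; last by rewrite mulr0.
      by rewrite mulrC [sgn_seq _ _ * _]mulrC.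
    over.
  rewrite /= mulr_sumr.
  under [RHS]eq_bigr => y _ do rewrite mulr_sumr mulr_sumr big_mkcondr /=.
  rewrite exchange_big /=; apply: eq_bigr => S' _; rewrite mulr_sumr.
  rewrite big_mkcond /=; apply: eq_bigr => y _.
  case: ifP => //= _; case: ifP => _; last by rewrite mulr0.
  by rewrite mulrC !mulrA.
congr (_ * _); rewrite !big_seq; apply: eq_bigr => y; rewrite mem_enum => yC.
congr (_ * _); rewrite /coef_ext uniq_rem_cat set_rem_cat /=.
set Y := _ :|: _.
have condE S' : (S' :&: C == C :\ y) && (S' :\: C == S :\: C) = (S' == Y).
  apply/andP/eqP => [[/eqP e1 /eqP e2]|->].
    by rewrite -(setID S' C) e1 e2.
  by split; apply/eqP/setP => z; rewrite !inE; case: (z \in C);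
    rewrite ?andbF ?orbF ?andbT.
under eq_bigl => S' do rewrite condE.
have iY : basisS b Y = indep b Y by rewrite /basisS cardY // eqxx.
case: ifP => iY'.
  by rewrite (big_pred1 Y) // => S' /=; case: eqVneq => [->|]; rewrite ?iY ?iY' ?andbF.
(* If [Y] is dependent, no basis set equals it, in agreement with the value 0 of [coef_ext]. *)
by rewrite big1 // => S' /andP[bS' /eqP YE]; move: bS'; rewrite YE iY iY'.
Qed.

End CircuitOperator.

(** * The singular vector and Gauss-Manin equations modulo a good prime *)

Section GaussManin.
Variables (n k' : nat).
Local Notation k := k'.+1.
Variables (b : 'I_k -> 'I_n -> int) (a : 'I_n -> int) (kappa : int) (p : nat)
  (lam : {set 'I_n} -> 'I_n -> int) (A : 'I_n -> nat) (q : 'I_k -> int)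
  (l : 'I_k -> nat).
Hypotheses (lamP : forall C, circuit b C -> lambda_ok b lam C)
  (p_prime : prime p) (goodp : good_prime b p lam)
  (A_gt0 : forall j, (0 < A j)%N)
  (AE : forall j, (A j)%:R * kappa%:~R = (a j)%:~R :> 'F_p)
  (l_gt0 : forall i, (0 < l i)%N).

Local Notation R := {mpoly 'F_p[n]}.
Let m := [multinom (l i * p).-1 | i < k].
Local Notation H e := (hprod b q ('F_p : comNzRingType) m e).
Local Notation Iv := (Ivec b p A q l).
Local Notation aF := (fun j => (a j)%:~R : R).

Let kA (j : 'I_n) : kappa%:~R * (A j)%:R = (a j)%:~R :> R.
Proof.
rewrite mulrC -(rmorph_int (@mpolyC n _)) -[(a j)%:~R](rmorph_int (@mpolyC n _)).
by rewrite -mpolyC_nat -mpolyCM AE.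
Qed.

Let m_char i : (m i).+1%:R = 0 :> 'F_p.
Proof.
rewrite mnmE prednK ?muln_gt0 ?l_gt0 ?prime_gt0 // natrM.
by rewrite pchar_Fp_0 // mulr0.
Qed.

Let indepE S : indepF b 'F_p S = indep b S.
Proof. by apply: eq_indepF; case: goodp. Qed.

Lemma Ivec_hprod S : basisS b S ->
  Iv S = (dS b S)%:~R * H (fun j => A j - (j \in S))%N.
Proof.
move=> bS; rewrite ffunE bS /Itaylor.
rewrite -[map_mpoly _ _]/(map_mpoly (intr : {rmorphism int -> 'F_p}) _).
rewrite -[map_mpoly _ _](mcoeff_map_mpoly (map_mpoly (intr : {rmorphism int -> 'F_p}))).
rewrite /Xpoly !rmorphM /= !rmorph_int !rmorph_prod /=.
rewrite -(rmorph_int (@mpolyC k R)) mcoeffCM; congr (_ * _@__).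
by apply: eq_bigr => j _; rewrite !rmorphXn /= fpoly_shift map_hpoly.
Qed.

(** The extension by zero is automatic: for repeated entries the determinant vanishes, for dependent
    entries it vanishes mod p because p is good, and otherwise both sides change by the same
    sign. *)
Lemma coef_ext_Ivec w : size w = k ->
  coef_ext b Iv w = (detb b w)%:~R * H (fun j => A j - (j \in w))%N.
Proof.
move=> sz; rewrite /coef_ext; case: (boolP (uniq w)) => [uw|nu] /=; last first.
  by rewrite detb_nuniq // mulr0z mul0r.
case: ifP => iw; last first.
  have := detb_neq0 b 'F_p uw sz; rewrite indepE iw => /negbFE/eqP d0.
  by rewrite -(rmorph_int (@mpolyC n 'F_p)) d0 rmorph0 mul0r.
have bw : basisS b [set x in w].
  rewrite /basisS iw andbT -sz -(card_uniqP uw).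
  by apply/eqP/eq_card => x; rewrite inE.
rewrite Ivec_hprod // mulrA detb_sgn_seq // rmorphM /= rmorph_sign.
congr (_ * _@__); apply: eq_bigr => j _.
by rewrite inE.
Qed.

Lemma Ivec_singular : singular_eqs b aF Iv.
Proof.
move=> t; have [c cE] := detb_cons b t.
have E := hprod_exact b q m_char c (fun j => A j - (j \in t))%N.
(* The singular vector sum is [kappa] times the exact sum [E]: terms with [x] in [t] vanish on both
   sides, and for the others the exponent of f_x is the full [A x], with [kappa] times [A x] equal
   to [a x]. *)
rewrite -[RHS](mulr0 kappa%:~R) -[in RHS]E mulr_sumr.
apply: eq_bigr => x _; rewrite coef_ext_Ivec /= ?size_tuple // -cE.
case: (boolP (x \in t)) => xt.
  by rewrite detb_nuniq ?mulr0z ?(mul0r, mulr0) //= ?size_tuple // xt.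
rewrite subn0 !mulrA kA; congr (_ * _@__); apply: eq_bigr => j _.
rewrite inE -subnDA addnC; congr (_ ^+ (_ - _)).
by case: eqVneq => [->|]; rewrite ?(negbTE xt).
Qed.

(** If the coefficient at some [i] in [C] vanished mod p, the reduced relation would live on
    [C :\ i], which is independent mod p by goodness; then all coefficients would vanish, against
    the nonvanishing of the reduced f_C. *)
Lemma lam_circuit C i : circuit b C ->
  ((lam C i)%:~R != 0 :> 'F_p) = (i \in C).
Proof.
move=> cC; have [_ lam0 rel _] := lamP cC; have [_ _ fC circE] := goodp.
case: (boolP (i \in C)) => [iC|/lam0 ->]; last by rewrite eqxx.
apply: contraTneq (fC C cC) => li0; rewrite negbK; apply/eqP.
move: cC; rewrite -circE => /andP[_ /forallP/(_ (C :\ i))/implyP].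
move=> /(_ (properD1 iC))/indepFP/(_ (fun j => (lam C j)%:~R)) H0.
rewrite /fCpoly big1 // => j _; rewrite H0 ?scale0r //.
  move=> x; rewrite !inE negb_and negbK => /orP[/eqP->//|/lam0->].
  by rewrite mulr0z.
apply/rowP => x; rewrite summxE mxE.
under eq_bigr => y _ do rewrite !mxE -intrM.
by rewrite -rmorph_sum /= (gpoly_relation rel).
Qed.

Section Basis.
Variable S : {set 'I_n}.
Hypothesis bS : basisS b S.

Let cardS : #|S| = k. Proof. by case/andP: bS => /eqP. Qed.
Let indS : indep b S. Proof. by case/andP: bS. Qed.

(** For a circuit [C] and [x] outside the basis [S], this says that [C] is the fundamental circuit
    of [x] with respect to [S]. *)
Let fund (C : {set 'I_n}) (x : 'I_n) := (x \in C) && (C :\ x \subset S).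

Let fundI C x : x \notin S -> fund C x -> S :&: C = C :\ x.
Proof.
move=> xS /andP[xC /subsetP sub]; apply/setP => z; have := sub z.
rewrite !inE; case: eqVneq => [->|_] /=; first by rewrite (negbTE xS).
by case: (z \in C) => [->|] //; rewrite andbF.
Qed.

(** The identity holds term by term in [y] from [C]: raising the exponent of f_y turns the exponents
    for [S] and [x] into those for the set obtained by replacing [y] with [x], and [detb_rem]
    matches the coefficients. *)
Lemma LC_fundamental C x : circuit b C -> x \notin S -> fund C x ->
  fCpoly 'F_p lam C *
    ((a x)%:~R * (dS b S)%:~R * H (fun j => A j - (j \in S) - (j == x))%N) =
  (lam C x)%:~R * LC b aF C Iv S.
Proof.
move=> cC xS fCx; have [_ lam0 rel _] := lamP cC.
have [xC sub] := andP fCx; have SC := fundI xS fCx.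
set c := enum C; set s := enum (S :\: C).
have szcs : (size c + size s = k'.+2)%N.
  rewrite -!cardE; have := cardsID C S; rewrite SC cardS => <-.
  by rewrite (cardsD1 x C) xC addSn.
have szr y : y \in C -> size (rem y c ++ s) = k.
  move=> yC; rewrite size_cat size_rem ?mem_enum //.
  have c0 : (0 < size c)%N by rewrite -cardE (cardsD1 x) xC.
  by move: szcs; rewrite -(prednK c0) addSn => -[].
rewrite (LC_coef _ _ bS xC SC) mulrCA (fC_hprod _ _ _ _ rel).
have -> : dS b S = sgn_seq int (rem x c ++ s) * detb b (rem x c ++ s).
  rewrite detb_sgn_seq ?uniq_rem_cat ?szr // set_rem_cat -SC setID mulrA.
  by rewrite /sgn_seq -expr2 sqrr_sign mul1r.
rewrite (bigID (mem C)) /= [X in _ + X]big1 ?addr0 => [|j /lam0 ->]; last first.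
  by rewrite mulr0z mul0r.
rewrite -big_enum /= -/c -/s [LHS]mulr_sumr [RHS]mulrA [RHS]mulr_sumr.
rewrite !big_seq; apply: eq_bigr => y; rewrite mem_enum => yC.
rewrite coef_ext_Ivec ?szr //.
(* At index [y] a factor is removed and then restored; positivity of [A] makes this exact despite
   truncated subtraction. *)
have -> : H (fun i => A i - (i \in S) - (i == x) + (i == y))%N =
          H (fun j => A j - (j \in rem y c ++ s))%N.
  congr (_@__); apply: eq_bigr => j _; congr (_ ^+ _).
  have -> : j \in rem y c ++ s = (j \in (C :\ y) :|: (S :\: C)).
    by rewrite -set_rem_cat inE.
  move/setP/(_ j): SC; rewrite !inE; have := A_gt0 j.
  case: (A j) => // Aj _; have [->|jx] := eqVneq j x.
    rewrite xC (negbTE xS) /= !andbT.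
    by case: eqVneq; rewrite ?subn0 ?subn1 ?addn0 ?addn1.
  have [->|jy] := eqVneq j y.
    by rewrite yC /= andbT => ->; rewrite subn0 subn1 addn1.
  by rewrite subn0 addn0 /=; case: (j \in S); case: (j \in C).
have [xc yc] : x \in c /\ y \in c by rewrite !mem_enum.
have supp j : j \notin c -> lam C j = 0 by rewrite mem_enum; apply: lam0.
have := detb_rem rel (enum_uniq C) xc yc szcs supp.
move=> /(congr1 (fun z => z%:~R : R)); rewrite !intrM !rmorph_sign => E.
set h := H _; set sg := (sgn_seq R _).
rewrite -[(-1) ^+ ninv _]/sg.
set e := (-1) ^+ index x c in E *.
have e2 : e * e = 1 by rewrite -expr2 sqrr_sign.
set Dx := (detb b (rem x c ++ s))%:~R in E *.
transitivity ((e * e) * ((a x)%:~R * (sg * Dx) * ((lam C y)%:~R * h))).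
  by rewrite e2 mul1r.
transitivity ((a x)%:~R * sg * h * e * ((lam C y)%:~R * (e * Dx))); first by ring.
by rewrite E; ring.
Qed.

Local Notation K := {fraction R}.

Let frac_int_eq0 (z : int) : (z%:~R == 0 :> K) = (z%:~R == 0 :> 'F_p).
Proof.
rewrite -(rmorph_int (@FracField.tofrac R)) tofrac_eq0.
by rewrite -(rmorph_int (@mpolyC n 'F_p)) mpolyC_eq0.
Qed.

(* The ratio lambda^i / lambda^x for the fundamental circuit of [x]: when
   [i \in S] it is the coordinate of [- g_x] along [g_i], by Cramer's rule. *)
Definition circuit_ratio (i x : 'I_n) : K :=
  if i \in S then
    - (detb b (x :: rem i (enum S)))%:~R / (detb b (i :: rem i (enum S)))%:~R
  else (x == i)%:R.

Let size_remS i : i \in S -> size (rem i (enum S)) = k'.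
Proof. by move=> iS; rewrite size_rem ?mem_enum // -cardE cardS. Qed.

Let mem_remS i j : (j \in rem i (enum S)) = (j != i) && (j \in S).
Proof. by rewrite mem_rem_uniq ?enum_uniq // inE mem_enum. Qed.

Let detb_remS_neq0 i : i \in S ->
  (detb b (i :: rem i (enum S)))%:~R != 0 :> 'F_p.
Proof.
move=> iS; rewrite detb_neq0 /= ?size_remS // ?rem_uniq ?enum_uniq ?andbT //.
  rewrite indepE (_ : [set _ | _] = S) //; apply/setP => j.
  by rewrite !inE mem_remS; case: eqVneq => [->|].
by rewrite mem_remS eqxx.
Qed.

(** For [i] in [S] this is [detb_relation2] with [w] the rest of [S], since [C] lies in [S] together
    with [x]; outside [S] the only element of [C] is [x]. *)
Lemma lam_circuit_ratio C x i : circuit b C -> x \notin S -> fund C x ->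
  (lam C i)%:~R = circuit_ratio i x * (lam C x)%:~R.
Proof.
move=> cC xS /andP[xC /subsetP sub]; have [_ lam0 rel _] := lamP cC.
rewrite /circuit_ratio; case: ifP => iS; last first.
  case: eqVneq => [->|xi]; first by rewrite mul1r.
  rewrite lam0 ?mulr0z ?mul0r //; apply: contraFN iS => iC.
  by apply: sub; rewrite !inE eq_sym xi.
have nz := detb_remS_neq0 iS; rewrite -frac_int_eq0 in nz.
apply: (mulIf nz); rewrite -intrM (detb_relation2 rel (x := x)) ?size_remS //.
- by rewrite mulrAC mulfVK // mulNr -intrM -mulrNz mulrC.
- by apply: contraNneq xS => ->.
move=> j nzj; rewrite !inE mem_remS; case: eqVneq => //= jx.
case: eqVneq => //= ji; apply: sub; rewrite !inE jx.
by apply: contraNT nzj => /lam0 ->.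
Qed.

Lemma fundamental_circuit x : x \notin S ->
  exists C, forall C', (circuit b C' && fund C' x) = (C' == C).
Proof.
move=> xS; have ex : exists2 C, circuit b C & fund C x.
  have: ~~ indep b (x |: S).
    (* Adding [x] to [S] gives k+1 vectors in dimension k; a circuit among them contains [x] because
       [S] is independent. *)
    by apply/negP => /indepF_card; rewrite cardsU1 xS cardS ltnn.
  case/dependent_circuitF => C cC /subsetP CS; exists C => //.
  have sub : C :\ x \subset S.
    apply/subsetP => z; rewrite !inE => /andP[/negbTE zx /CS].
    by rewrite !inE zx.
  rewrite /fund sub andbT; apply: contraT => xC; case/andP: cC => /negP[].
  by apply: indepFS indS; apply/subsetP => z zC; apply: (subsetP sub);
    rewrite !inE zC andbT; apply: contraNneq xC => <-.
case: ex => C cC fC; exists C => C'; apply/andP/eqP => [[cC' fC']|-> //].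
(* Uniqueness: a circuit is the support mod p of its relation, and up to a nonzero factor that
   relation is given by ratios depending on [S] and [x] only. *)
apply/setP => i; rewrite -!lam_circuit // -!frac_int_eq0.
rewrite (lam_circuit_ratio _ cC xS fC) (lam_circuit_ratio _ cC' xS fC').
rewrite !mulf_eq0 !frac_int_eq0.
have /andP[xC _] := fC; have /andP[xC' _] := fC'.
by move: xC xC'; rewrite -!lam_circuit // => /negbTE -> /negbTE ->.
Qed.

Lemma fundamental_elt C x y : x \notin S -> y \notin S ->
  fund C x -> fund C y -> x = y.
Proof.
move=> xS yS /andP[_ /subsetP sub] /andP[yC _]; apply/eqP.
by apply: contraNT yS => xy; apply: sub; rewrite !inE eq_sym xy.
Qed.

(** The Taylor coefficient of a_x d_S Phi / (f_x f_S), the common quantity through which the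
    derivative of I and the operators L_C are compared. *)
Let E x : R :=
  (a x)%:~R * (dS b S)%:~R * H (fun j => A j - (j \in S) - (j == x))%N.

Lemma kappa_mderiv_Ivec i :
  (kappa%:~R : R)%:F * ((Iv S)^`M(i))%:F =
  \sum_(x | x \notin S) circuit_ratio i x * (E x)%:F.
Proof.
rewrite Ivec_hprod // mderivM mderiv_int mul0r add0r mderiv_hprod.
rewrite /circuit_ratio; case: (boolP (i \in S)) => iS; last first.
  rewrite [RHS](bigD1 i) //= eqxx mul1r [X in _ = _ + X]big1 ?addr0.
    by rewrite -tofracM /E subn0 -kA; congr (_ %:F); ring.
  by move=> x /andP[_ /negbTE ->]; rewrite mul0r.
have nz := detb_remS_neq0 iS; rewrite -frac_int_eq0 in nz.
set w := rem i (enum S) in nz *.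
(* On the cofactor vector [c] the form g_x takes the value [detb b (x :: w)], which is 0 for the
   other elements of [S]; it is the dual vector of g_i scaled by [detb b (i :: w)]. *)
have [c cE] := detb_cons b w.
have ex := hprod_exact b q m_char c (fun j => A j - (j \in S))%N.
rewrite (bigID (mem S)) /= (bigD1 i) //= [X in _ + X + _]big1 in ex; last first.
  move=> x /andP[xS xi]; rewrite -cE detb_nuniq ?mulr0z ?mulr0 ?mul0r //=.
    by rewrite size_remS.
  by rewrite mem_remS xi xS.
apply: (mulIf nz); rewrite mulr_suml.
move/eqP: ex; rewrite addr0 addr_eq0 -cE iS => /eqP ex.
(* Exactness along [c] expresses the term of [i] as minus the sum over [x] outside [S], whence the
   sign in [circuit_ratio]. *)
rewrite -[(detb b (i :: w))%:~R](rmorph_int (@FracField.tofrac R)) -!tofracM.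
transitivity ((kappa%:~R * (dS b S)%:~R * ((A i - true)%:R *
  (detb b (i :: w))%:~R * H (fun j => A j - (j \in S) - (j == i))%N))%:F : K).
  by congr (_ %:F); ring.
rewrite ex mulrN mulr_sumr tofracN raddf_sum -sumrN /=.
apply: eq_bigr => x xS; rewrite -cE.
rewrite (rmorph_int (@FracField.tofrac R)) [RHS]mulrAC [X in _ = X * _]mulfVK //.
rewrite -(rmorph_int (@FracField.tofrac R)) -!tofracN -tofracM.
congr (_ %:F); rewrite (negbTE xS) subn0 /E -kA; ring.
Qed.

Lemma Ivec_gauss_manin_basis i :
  (kappa%:~R : R)%:F * ((Iv S)^`M(i))%:F =
  \sum_(C | circuit b C)
     ((lam C i)%:~R : R)%:F / (fCpoly 'F_p lam C)%:F * (LC b aF C Iv S)%:F.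
Proof.
rewrite kappa_mderiv_Ivec.
(* The sum over [x] is regrouped by the fundamental circuit of [x]; a circuit is fundamental for at
   most one [x]. *)
transitivity (\sum_(C | circuit b C) \sum_(x | (x \notin S) && fund C x)
    circuit_ratio i x * (E x)%:F).
  rewrite (exchange_big_dep (fun x => x \notin S)) /=; last by move=> C x _ /andP[].
  apply: eq_bigr => x xS; have [C CE] := fundamental_circuit xS.
  by rewrite (big_pred1 C) // => C'; rewrite xS /= -CE.
apply: eq_bigr => C cC.
case: (pickP (fun x => (x \notin S) && fund C x)) => [x /andP[xS fx]|none].
  rewrite (big_pred1 x) => [|y]; last first.
    apply/andP/eqP => [[yS fy]|-> //]; exact: fundamental_elt fy fx.
  have [_ _ fC0 _] := goodp; have fCn0 := fC0 C cC.
  rewrite -tofrac_eq0 in fCn0.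
  have := LC_fundamental cC xS fx; rewrite -/(E x).
  move=> /(congr1 (@FracField.tofrac R)); rewrite !tofracM => LE.
  have -> : ((lam C i)%:~R : R)%:F = circuit_ratio i x * ((lam C x)%:~R : R)%:F.
    by rewrite !(rmorph_int (@FracField.tofrac R)); apply: lam_circuit_ratio.
  rewrite -!mulrA; congr (_ * _).
  rewrite [_^-1 * _]mulrC [RHS]mulrA -LE [RHS]mulrAC.
  by rewrite (mulfV fCn0) mul1r mulrA.
(* A circuit that is fundamental for no [x] contributes nothing: [S :&: C = C :\ x] would force [x]
   outside [S] and make [C] its fundamental circuit. *)
rewrite big_pred0 // LC_eq0 ?rmorph0 ?mulr0 // => x xC _.
apply/negP => /eqP SC; have := none x; rewrite /fund xC -SC subsetIl !andbT.
move=> /negbFE xS.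
by move/setP/(_ x): SC; rewrite !inE eqxx xS xC.
Qed.

End Basis.

(** Coordinates at sets that do not index a basis vector vanish on both sides. *)
Lemma Ivec_gauss_manin i S :
  (kappa%:~R : R)%:F * ((Iv S)^`M(i))%:F =
  \sum_(C | circuit b C)
     ((lam C i)%:~R : R)%:F / (fCpoly 'F_p lam C)%:F * (LC b aF C Iv S)%:F.
Proof.
have [bS|nbS] := boolP (basisS b S); first exact: Ivec_gauss_manin_basis.
rewrite ffunE (negbTE nbS) mderiv0 rmorph0 mulr0 big1 // => C _.
rewrite LC_eq0 ?rmorph0 ?mulr0 // => x _ bS.
by rewrite bS in nbS.
Qed.

End GaussManin.

Theorem theorem4p3 (n k : nat) (b : 'I_k -> 'I_n -> int)
  (a : 'I_n -> int) (kappa : int) (p : nat)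
  (lam : {set 'I_n} -> 'I_n -> int)
  (A : 'I_n -> nat) (q : 'I_k -> int) (l : 'I_k -> nat) :
  (0 < k)%N -> (k < n)%N ->
  (forall j, gpoly b int j != 0) ->
  spans_k b ->
  (forall C, circuit b C -> lambda_ok b lam C) ->
  (forall j, a j != 0) ->
  prime p -> good_prime b p lam -> ~~ (p%:Z %| kappa)%Z ->
  (forall j, (0 < A j)%N) ->
  (forall j, (A j)%:R = (a j)%:~R / kappa%:~R :> 'F_p) ->
  (forall i, (0 < l i)%N) ->
  let I := Ivec b p A q l in
  let aF := fun j => ((a j)%:~R : {mpoly 'F_p[n]}) in
  singular_eqs b aF I /\
  forall (i : 'I_n) (S : {set 'I_n}),
    (kappa%:~R : {mpoly 'F_p[n]})%:F * ((I S)^`M(i))%:F =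
    \sum_(C : {set 'I_n} | circuit b C)
       ((lam C i)%:~R : {mpoly 'F_p[n]})%:F / (fCpoly 'F_p lam C)%:F
         * ((LC b aF C I) S)%:F.
Proof.
case: k b q l => // k b q l _ _ _ _ lamP _ pp good pk A0 AE l0 I aF.
(* The denominator can be cleared because p does not divide [kappa]. *)
have AE' j : (A j)%:R * kappa%:~R = (a j)%:~R :> 'F_p.
  by rewrite AE divfK // -(dvdz_pcharf (pchar_Fp pp)).
split; first exact: (Ivec_singular (kappa := kappa) (lam := lam)).
by move=> i S; apply: Ivec_gauss_manin.
Qed.
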